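(* Let $a,b,c$ be integers. The generating function (as a formal power series in $x$) of the unrestricted modified third-order Jacobsthal quaternions is $$\sum_{j=0}^{\infty}\mathcal{QK}_{j}^{(a,b,c)}x^{j}=\frac{\Theta(1+x+x^{2})+\Phi_{1}\left(1+(\omega_{1}-1)x+2\omega_{2}x^{2}\right)+\Phi_{2}\left(1+(\omega_{2}-1)x+2\omega_{1}x^{2}\right)}{1-x-x^{2}-2x^{3}},$$ where $\Theta=1+2^{a}\mathbf{i}+2^{b}\mathbf{j}+2^{c}\mathbf{k}$, $\Phi_{1}=1+\omega_{1}^{a}\mathbf{i}+\omega_{1}^{b}\mathbf{j}+\omega_{1}^{c}\mathbf{k}$ and $\Phi_{2}=1+\omega_{2}^{a}\mathbf{i}+\omega_{2}^{b}\mathbf{j}+\omega_{2}^{c}\mathbf{k}$.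
   Context: Let $\omega_1=\frac{-1+i\sqrt3}{2}$ and $\omega_2=\frac{-1-i\sqrt3}{2}$, where $i$ is the complex imaginary unit. The modified third-order Jacobsthal numbers are $K_m^{(3)}=2^m+\omega_1^m+\omega_2^m$; this formula is used for all integers $m$ (rational values for negative $m$). Quaternions have basis $1,\mathbf{i},\mathbf{j},\mathbf{k}$ with $\mathbf{i}^2=\mathbf{j}^2=\mathbf{k}^2=-1$, $\mathbf{i}\mathbf{j}=-\mathbf{j}\mathbf{i}=\mathbf{k}$, $\mathbf{j}\mathbf{k}=-\mathbf{k}\mathbf{j}=\mathbf{i}$, $\mathbf{k}\mathbf{i}=-\mathbf{i}\mathbf{k}=\mathbf{j}$. Expressions with complex coefficients are read in the complexified quaternion algebra $\mathbb{C}\otimes_{\mathbb{R}}\mathbb{H}$, where complex scalars (in particular $\omega_1,\omega_2$, whose imaginary unit $i$ is distinct from $\mathbf{i}$) commute with $\mathbf{i},\mathbf{j},\mathbf{k}$; the variable $x$ is central. The unrestricted modified third-order Jacobsthal quaternion is $\mathcal{QK}_{n}^{(a,b,c)}=K_{n}^{(3)}+K_{n+a}^{(3)}\mathbf{i}+K_{n+b}^{(3)}\mathbf{j}+K_{n+c}^{(3)}\mathbf{k}$, where $a,b,c$ are fixed integers. *)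

(* Defs.v *)
From HB Require Import structures.
From mathcomp Require Import all_boot all_order all_algebra.
From mathcomp Require Import ring.
From mathcomp Require Import boolp reals complex.

Set Implicit Arguments.
Unset Strict Implicit.
Unset Printing Implicit Defensive.

Import Order.TTheory GRing.Theory Num.Theory.

Local Open Scope ring_scope.

(* quat R is the algebra R (x) H of Hamilton quaternions with coefficients in
   a commutative ring R; it is an R-algebra, so scalars commute with the basis
   1, quat_i, quat_j, quat_k. In particular quat R[i], for R real, is the
   complexified quaternion algebra (which has zero divisors); its quat_i is
   unrelated to the imaginary unit of R[i]. *)

Record quat (R : Type) := Quat { qre : R; qi : R; qj : R; qk : R }.

Definition quat_tuple (R : Type) (q : quat R) : R * R * R * R :=
  (qre q, qi q, qj q, qk q).
Definition tuple_quat (R : Type) (t : R * R * R * R) : quat R :=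
  let: (w, x, y, z) := t in Quat w x y z.
Lemma quat_tupleK (R : Type) : cancel (@quat_tuple R) (@tuple_quat R).
Proof. by case. Qed.

HB.instance Definition _ (R : eqType) :=
  Equality.copy (quat R) (can_type (@quat_tupleK R)).
HB.instance Definition _ (R : choiceType) :=
  Choice.copy (quat R) (can_type (@quat_tupleK R)).

Section QuatZmodule.
Variable R : zmodType.
Implicit Types p q : quat R.

Definition quat0 : quat R := Quat 0 0 0 0.
Definition quat_opp p := Quat (- qre p) (- qi p) (- qj p) (- qk p).
Definition quat_add p q :=
  Quat (qre p + qre q) (qi p + qi q) (qj p + qj q) (qk p + qk q).

Lemma quat_addA : associative quat_add.
Proof. by move=> [????] [????] [????]; rewrite /quat_add /= !addrA. Qed.
Lemma quat_addC : commutative quat_add.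
Proof.
by move=> [a b c d] [????]; rewrite /quat_add /= (addrC a) (addrC b) (addrC c)
  (addrC d).
Qed.
Lemma quat_add0 : left_id quat0 quat_add.
Proof. by move=> [????]; rewrite /quat_add /= !add0r. Qed.
Lemma quat_addN : left_inverse quat0 quat_opp quat_add.
Proof. by move=> [????]; rewrite /quat_add /= !addNr. Qed.

HB.instance Definition _ := GRing.isZmodule.Build (quat R)
  quat_addA quat_addC quat_add0 quat_addN.
End QuatZmodule.

Section QuatAlgebra.
Variable R : comNzRingType.
Implicit Types p q : quat R.

Definition quat1 : quat R := Quat 1 0 0 0.
Definition quat_i : quat R := Quat 0 1 0 0.
Definition quat_j : quat R := Quat 0 0 1 0.
Definition quat_k : quat R := Quat 0 0 0 1.

Definition quat_mul p q := Quat
  (qre p * qre q - qi p * qi q - qj p * qj q - qk p * qk q)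
  (qre p * qi q + qi p * qre q + qj p * qk q - qk p * qj q)
  (qre p * qj q - qi p * qk q + qj p * qre q + qk p * qi q)
  (qre p * qk q + qi p * qj q - qj p * qi q + qk p * qre q).

Lemma quat_mulA : associative quat_mul.
Proof.
by move=> [????] [????] [????]; rewrite /quat_mul /=; congr Quat; ring.
Qed.
Lemma quat_mul1q : left_id quat1 quat_mul.
Proof. by move=> [????]; rewrite /quat_mul /=; congr Quat; ring. Qed.
Lemma quat_mulq1 : right_id quat1 quat_mul.
Proof. by move=> [????]; rewrite /quat_mul /=; congr Quat; ring. Qed.
Lemma quat_mulDl : left_distributive quat_mul +%R.
Proof.
by move=> [????] [????] [????]; rewrite /quat_mul /=; congr Quat => /=; ring.
Qed.
Lemma quat_mulDr : right_distributive quat_mul +%R.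
Proof.
by move=> [????] [????] [????]; rewrite /quat_mul /=; congr Quat => /=; ring.
Qed.
Lemma quat1_neq0 : quat1 != 0.
Proof. by apply/eqP => -[] /eqP; rewrite oner_eq0. Qed.

HB.instance Definition _ := GRing.Zmodule_isNzRing.Build (quat R)
  quat_mulA quat_mul1q quat_mulq1 quat_mulDl quat_mulDr quat1_neq0.

Definition quat_scale (a : R) q := Quat (a * qre q) (a * qi q) (a * qj q) (a * qk q).

Lemma quat_scaleA a b q : quat_scale a (quat_scale b q) = quat_scale (a * b) q.
Proof. by rewrite /quat_scale /= !mulrA. Qed.
Lemma quat_scale1 : left_id 1 quat_scale.
Proof. by move=> [????]; rewrite /quat_scale /= !mul1r. Qed.
Lemma quat_scaleDr : right_distributive quat_scale +%R.
Proof. by move=> a [????] [????]; rewrite /quat_scale /= !mulrDr. Qed.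
Lemma quat_scaleDl q : {morph quat_scale^~ q : a b / a + b}.
Proof. by move=> a b; rewrite /quat_scale /= !mulrDl. Qed.

HB.instance Definition _ := GRing.Zmodule_isLmodule.Build R (quat R)
  quat_scaleA quat_scale1 quat_scaleDr quat_scaleDl.

Lemma quat_scaleAl (a : R) p q : a *: (p * q) = (a *: p) * q.
Proof.
by case: p q => [????] [????]; congr Quat => /=; ring.
Qed.
HB.instance Definition _ :=
  GRing.Lmodule_isLalgebra.Build R (quat R) quat_scaleAl.

Lemma quat_scaleAr (a : R) p q : a *: (p * q) = p * (a *: q).
Proof.
by case: p q => [????] [????]; congr Quat => /=; ring.
Qed.
HB.instance Definition _ :=
  GRing.Lalgebra_isAlgebra.Build R (quat R) quat_scaleAr.

Lemma quat_ii : quat_i * quat_i = - 1.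
Proof. by congr Quat => /=; ring. Qed.
Lemma quat_jj : quat_j * quat_j = - 1.
Proof. by congr Quat => /=; ring. Qed.
Lemma quat_kk : quat_k * quat_k = - 1.
Proof. by congr Quat => /=; ring. Qed.
Lemma quat_ij : quat_i * quat_j = quat_k.
Proof. by congr Quat => /=; ring. Qed.
Lemma quat_ji : quat_j * quat_i = - quat_k.
Proof. by congr Quat => /=; ring. Qed.
Lemma quat_jk : quat_j * quat_k = quat_i.
Proof. by congr Quat => /=; ring. Qed.
Lemma quat_kj : quat_k * quat_j = - quat_i.
Proof. by congr Quat => /=; ring. Qed.
Lemma quat_ki : quat_k * quat_i = quat_j.
Proof. by congr Quat => /=; ring. Qed.
Lemma quat_ik : quat_i * quat_k = - quat_j.
Proof. by congr Quat => /=; ring. Qed.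

Definition quat_conj q := Quat (qre q) (- qi q) (- qj q) (- qk q).
Definition quat_norm q := qre q ^+ 2 + qi q ^+ 2 + qj q ^+ 2 + qk q ^+ 2.

Lemma quat_normM p q : quat_norm (p * q) = quat_norm p * quat_norm q.
Proof. by case: p q => [????] [????]; rewrite /quat_norm /=; ring. Qed.
Lemma quat_norm1 : quat_norm 1 = 1.
Proof. by rewrite /quat_norm /=; ring. Qed.
Lemma quat_conjMl q : quat_conj q * q = (quat_norm q)%:A.
Proof.
by case: q => [????]; congr Quat; rewrite /quat_norm /=; ring.
Qed.
Lemma quat_conjMr q : q * quat_conj q = (quat_norm q)%:A.
Proof.
by case: q => [????]; congr Quat; rewrite /quat_norm /=; ring.
Qed.
End QuatAlgebra.

Arguments quat_i {R}.
Arguments quat_j {R}.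
Arguments quat_k {R}.

Section QuatUnitRing.
Variable R : comUnitRingType.
Implicit Types p q : quat R.

Definition quat_unit : pred (quat R) :=
  fun q => quat_norm q \is a GRing.unit.
Definition quat_inv q :=
  if quat_unit q then (quat_norm q)^-1 *: quat_conj q else q.

Lemma quat_mulVq : {in quat_unit, left_inverse 1 quat_inv *%R}.
Proof.
move=> q; rewrite unfold_in /quat_inv => uq; rewrite ifT // -scalerAl.
by rewrite quat_conjMl scalerA mulVr // scale1r.
Qed.
Lemma quat_mulqV : {in quat_unit, right_inverse 1 quat_inv *%R}.
Proof.
move=> q; rewrite unfold_in /quat_inv => uq; rewrite ifT // -scalerAr.
by rewrite quat_conjMr scalerA mulVr // scale1r.
Qed.
Lemma quat_unitP p q : q * p = 1 /\ p * q = 1 -> quat_unit p.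
Proof.
move=> [_ /(congr1 (@quat_norm R))]; rewrite quat_normM quat_norm1 => pq1.
by apply/unitrPr; exists (quat_norm q).
Qed.
Lemma quat_inv_out : {in [predC quat_unit], quat_inv =1 id}.
Proof.
move=> q; rewrite inE unfold_in /quat_inv => /negbTE nuq.
by rewrite ifF.
Qed.

HB.instance Definition _ := GRing.NzRing_hasMulInverse.Build (quat R)
  quat_mulVq quat_mulqV quat_unitP quat_inv_out.
End QuatUnitRing.

(* fps A is the ring A[[x]] of formal power series in one central variable x,
   a series being the sequence of its coefficients. As for {poly A}, a *: f
   multiplies all the coefficients of f by a on the left. The ring A need not
   be commutative; f / g stands for f * g^-1, and g is invertible exactly when
   its constant coefficient is. *)

Record fps (A : Type) := Fps { fps_coef : nat -> A }.

HB.instance Definition _ (A : Type) := gen_eqMixin (fps A).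
HB.instance Definition _ (A : Type) := gen_choiceMixin (fps A).

Lemma fpsP (A : Type) (f g : fps A) : fps_coef f =1 fps_coef g -> f = g.
Proof. by case: f g => [f] [g] /= /funext ->. Qed.

Section FpsZmodule.
Variable A : zmodType.
Implicit Types f g : fps A.

Definition fps0 : fps A := Fps (fun=> 0).
Definition fps_opp f := Fps (fun n => - fps_coef f n).
Definition fps_add f g := Fps (fun n => fps_coef f n + fps_coef g n).

Lemma fps_addA : associative fps_add.
Proof. by move=> f g h; apply: fpsP => n; apply: addrA. Qed.
Lemma fps_addC : commutative fps_add.
Proof. by move=> f g; apply: fpsP => n; apply: addrC. Qed.
Lemma fps_add0 : left_id fps0 fps_add.
Proof. by move=> f; apply: fpsP => n; apply: add0r. Qed.
Lemma fps_addN : left_inverse fps0 fps_opp fps_add.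
Proof. by move=> f; apply: fpsP => n; apply: addNr. Qed.

HB.instance Definition _ := GRing.isZmodule.Build (fps A)
  fps_addA fps_addC fps_add0 fps_addN.
End FpsZmodule.

Section FpsRing.
Variable A : nzRingType.
Implicit Types f g : fps A.

Definition fps1 : fps A := Fps (fun n => (n == 0)%:R).
Definition fpsX : fps A := Fps (fun n => (n == 1)%:R).
Definition fps_mul f g :=
  Fps (fun n => \sum_(i < n.+1) fps_coef f i * fps_coef g (n - i)).

Let trunc (n : nat) f : {poly A} := \poly_(i < n.+1) fps_coef f i.

Let coef_trunc n f i : (i <= n)%N -> (trunc n f)`_i = fps_coef f i.
Proof. by move=> le_in; rewrite coef_poly ltnS le_in. Qed.

Let coef_mul_trunc n f g i : (i <= n)%N ->
  (trunc n f * trunc n g)`_i = fps_coef (fps_mul f g) i.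
Proof.
move=> le_in; rewrite coefM; apply: eq_bigr => -[j /= lt_ji] _.
have le_jn : (j <= n)%N by apply: leq_trans le_in; rewrite -ltnS.
by rewrite !coef_trunc // (leq_trans (leq_subr _ _)).
Qed.

Lemma fps_mulA : associative fps_mul.
Proof.
move=> f g h; apply: fpsP => n.
have -> : fps_coef (fps_mul f (fps_mul g h)) n
    = (trunc n f * (trunc n g * trunc n h))`_n.
  rewrite coefM; apply: eq_bigr => i _.
  by rewrite coef_mul_trunc ?leq_subr // coef_trunc // -ltnS.
rewrite mulrA coefM; apply: eq_bigr => i _.
by rewrite coef_mul_trunc -1?ltnS // coef_trunc // leq_subr.
Qed.
Lemma fps_mul1f : left_id fps1 fps_mul.
Proof.
move=> f; apply: fpsP => n; rewrite /= big_ord_recl /= mul1r subn0 big1 ?addr0 //.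
by move=> i _; rewrite mul0r.
Qed.
Lemma fps_mulf1 : right_id fps1 fps_mul.
Proof.
move=> f; apply: fpsP => n; rewrite /= big_ord_recr /= subnn mulr1 big1 ?add0r //.
by move=> i _; rewrite subn_eq0 leqNgt ltn_ord mulr0.
Qed.
Lemma fps_mulDl : left_distributive fps_mul +%R.
Proof.
move=> f g h; apply: fpsP => n; rewrite /= -big_split /=.
by apply: eq_bigr => i _; rewrite mulrDl.
Qed.
Lemma fps_mulDr : right_distributive fps_mul +%R.
Proof.
move=> f g h; apply: fpsP => n; rewrite /= -big_split /=.
by apply: eq_bigr => i _; rewrite mulrDr.
Qed.
Lemma fps1_neq0 : fps1 != 0.
Proof.
by apply/eqP => /(congr1 (fun f => fps_coef f 0))/eqP; rewrite oner_eq0.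
Qed.

HB.instance Definition _ := GRing.Zmodule_isNzRing.Build (fps A)
  fps_mulA fps_mul1f fps_mulf1 fps_mulDl fps_mulDr fps1_neq0.

Definition fps_scale (a : A) f := Fps (fun n => a * fps_coef f n).

Lemma fps_scaleA a b f : fps_scale a (fps_scale b f) = fps_scale (a * b) f.
Proof. by apply: fpsP => n; apply: mulrA. Qed.
Lemma fps_scale1 : left_id 1 fps_scale.
Proof. by move=> f; apply: fpsP => n; apply: mul1r. Qed.
Lemma fps_scaleDr : right_distributive fps_scale +%R.
Proof. by move=> a f g; apply: fpsP => n; apply: mulrDr. Qed.
Lemma fps_scaleDl f : {morph fps_scale^~ f : a b / a + b}.
Proof. by move=> a b; apply: fpsP => n; apply: mulrDl. Qed.

HB.instance Definition _ := GRing.Zmodule_isLmodule.Build A (fps A)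
  fps_scaleA fps_scale1 fps_scaleDr fps_scaleDl.

Lemma fps_scaleAl (a : A) f g : a *: (f * g) = (a *: f) * g.
Proof.
apply: fpsP => n; rewrite /= mulr_sumr.
by apply: eq_bigr => i _; rewrite mulrA.
Qed.
HB.instance Definition _ :=
  GRing.Lmodule_isLalgebra.Build A (fps A) fps_scaleAl.
End FpsRing.

Arguments fpsX {A}.

Section FpsUnitRing.
Variable A : unitRingType.
Implicit Types f g : fps A.

Definition fps_unit : pred (fps A) := fun f => fps_coef f 0 \is a GRing.unit.

(* The first n coefficients of f^-1, obtained by solving for g_m the equations
   \sum_(i <= m) g_i f_(m - i) = (m == 0) of g * f = 1. *)
Fixpoint fps_inv_seq f (n : nat) : seq A :=
  if n is m.+1 then
    let s := fps_inv_seq f m in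
    rcons s (((m == 0)%:R - \sum_(i < m) s`_i * fps_coef f (m - i))
             / fps_coef f 0)
  else [::].

Definition fps_inv f :=
  if fps_unit f then Fps (fun n => (fps_inv_seq f n.+1)`_n) else f.

Let size_fps_inv_seq f n : size (fps_inv_seq f n) = n.
Proof. by elim: n => //= n IHn; rewrite size_rcons IHn. Qed.

Let nth_fps_inv_seq f n i : (i < n)%N ->
  (fps_inv_seq f n)`_i = (fps_inv_seq f i.+1)`_i.
Proof.
elim: n => // n IHn; rewrite ltnS leq_eqVlt => /predU1P[-> // | lt_in].
by rewrite [LHS]/= nth_rcons size_fps_inv_seq lt_in IHn.
Qed.

Let fps_inv_seqE f n : (fps_inv_seq f n.+1)`_n =
  ((n == 0)%:R - \sum_(i < n) (fps_inv_seq f i.+1)`_i * fps_coef f (n - i))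
    / fps_coef f 0.
Proof.
rewrite [fps_inv_seq f n.+1]/= nth_rcons size_fps_inv_seq ltnn eqxx.
by congr ((_ - _) / _); apply: eq_bigr => i _; rewrite nth_fps_inv_seq.
Qed.

Lemma fps_mulVf : {in fps_unit, left_inverse 1 fps_inv *%R}.
Proof.
move=> f; rewrite unfold_in => uf; apply: fpsP => n; rewrite /fps_inv ifT //.
change (\sum_(i < n.+1) (fps_inv_seq f i.+1)`_i * fps_coef f (n - i)
  = (n == 0)%:R).
by rewrite big_ord_recr subnn fps_inv_seqE mulrVK //= addrC subrK.
Qed.

Let fps_inv_unit f : fps_unit f -> fps_unit (fps_inv f).
Proof.
move=> uf; rewrite /fps_inv ifT // /fps_unit /= big_ord0 subr0 div1r.
by rewrite unitrV.
Qed.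

Lemma fps_mulfV : {in fps_unit, right_inverse 1 fps_inv *%R}.
Proof.
move=> f; rewrite unfold_in => uf.
rewrite -[f in f * _]mul1r -(fps_mulVf (fps_inv_unit uf)) -[X in X * _]mulrA.
by rewrite (fps_mulVf uf) mulr1 (fps_mulVf (fps_inv_unit uf)).
Qed.
Lemma fps_unitP f g : g * f = 1 /\ f * g = 1 -> fps_unit f.
Proof.
move=> [gf1 fg1]; apply/unitrP; exists (fps_coef g 0).
move: (congr1 (fun h => fps_coef h 0) gf1) (congr1 (fun h => fps_coef h 0) fg1).
by rewrite /= !big_ord1 !subn0.
Qed.
Lemma fps_inv_out : {in [predC fps_unit], fps_inv =1 id}.
Proof.
move=> f; rewrite inE unfold_in /fps_inv => /negbTE nuf.
by rewrite ifF.
Qed.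

HB.instance Definition _ := GRing.NzRing_hasMulInverse.Build (fps A)
  fps_mulVf fps_mulfV fps_unitP fps_inv_out.
End FpsUnitRing.

Section Jacobsthal.
Variable R : realType.
Local Open Scope complex_scope.

Definition omega1 : R[i] := (- 1 + 'i%C * (Num.sqrt 3)%:C) / 2.
Definition omega2 : R[i] := (- 1 - 'i%C * (Num.sqrt 3)%:C) / 2.

Definition jacK (m : int) : R[i] := 2 ^ m + omega1 ^ m + omega2 ^ m.

Definition jacQK (a b c n : int) : quat R[i] :=
  (jacK n)%:A + jacK (n + a) *: quat_i + jacK (n + b) *: quat_j
  + jacK (n + c) *: quat_k.
End Jacobsthal.

Arguments omega1 {R}.
Arguments omega2 {R}.

(* Main.v *)
Require Import Defs.
From mathcomp Require Import all_boot all_order all_algebra.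
From mathcomp Require Import reals complex.
From mathcomp Require Import ring.
Import GRing.Theory Num.Theory.
Local Open Scope ring_scope.

(** The denominator D = 1 - x - x^2 - 2x^3 is the reversal of
    t^3 - t^2 - t - 2 = (t - 2)(t^2 + t + 1), whose roots are 2, w1 and w2.
    For each root z the geometric series in z x satisfies
    (sum_n z^n x^n) D = 1 + (z - 1) x + (z^2 - z - 1) x^2, and the quaternion
    series is the combination of the three geometric series with coefficients
    Theta, Phi1, Phi2. *)

Lemma fps_mulXE (A : nzRingType) (f : fps A) (n : nat) :
  fps_coef (f * fpsX) n = if n is m.+1 then fps_coef f m else 0.
Proof.
case: n => [|n] /=; first by rewrite big_ord1 mulr0.
rewrite big_ord_recr big_ord_recr /= subnn subSnn mulr0 mulr1 addr0.
rewrite big1 ?add0r // => i _.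
by rewrite subSn 1?ltnW // eqSS subn_eq0 leqNgt ltn_ord mulr0.
Qed.

(** The cubic relation, multiplied by a power of [z], cancels every coefficient from degree 3 on;
    only degrees 0, 1 and 2 survive. *)
Lemma fps_mul_geometric (A : nzRingType) (z : A) (f := Fps (fun n => z ^+ n)) :
  z ^+ 3 = z ^+ 2 + z + 2 ->
  f * (1 - fpsX - fpsX ^+ 2 - 2 *: fpsX ^+ 3)
  = 1 + (z - 1) *: fpsX + (z ^+ 2 - z - 1) *: fpsX ^+ 2.
Proof.
move=> z3; rewrite scaler_nat !mulrBr mulrnAr mulr1 (exprSr fpsX 2) (expr2 fpsX) !mulrA.
apply: fpsP => n; rewrite mulr2n.
(* Both sides unfold, by conversion, to coefficients in which [fpsX] occurs only as a right factor,
   the form that [fps_mulXE] evaluates. *)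
transitivity (fps_coef f n - fps_coef (f * fpsX) n
  - fps_coef (f * fpsX * fpsX) n
  - (fps_coef (f * fpsX * fpsX * fpsX) n
     + fps_coef (f * fpsX * fpsX * fpsX) n)); first by [].
transitivity ((n == 0)%:R + (z - 1) * (n == 1)%:R
  + (z ^+ 2 - z - 1) * fps_coef (fpsX * fpsX) n : A); last by [].
case: n => [|[|[|n]]]; rewrite !fps_mulXE /= ?expr0 ?mulr0 ?mulr1.
- by rewrite !addr0 !subr0.
- by rewrite expr1 !addr0 !subr0 add0r.
- by rewrite expr1 !addr0 !subr0 !add0r.
have -> : z ^+ n.+3 = z ^+ n.+2 + z ^+ n.+1 + (z ^+ n + z ^+ n).
  by rewrite -addn3 exprD z3 !mulrDr -exprD addn2 -exprSr mulr1.
by rewrite !addr0 -!addrA -!opprD !addrA subrr.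
Qed.

(** The embedding [in_alg] of scalars is a ring morphism, so it carries the cubic relation into [A].
    The separate [z'] lets the quadratic coefficient be given in simplified form. *)
Lemma fps_mul_geometric_alg (K : comNzRingType) (A : algType K) (z z' : K) :
  z ^+ 3 = z ^+ 2 + z + 2 -> z ^+ 2 - z - 1 = z' ->
  Fps (fun n => (z ^+ n)%:A : A)
    * (1 - fpsX - fpsX ^+ 2 - 2 *: fpsX ^+ 3)
  = 1 + (z - 1)%:A *: fpsX + z'%:A *: fpsX ^+ 2.
Proof.
move=> z3 <-; have algE x : x%:A = in_alg A x by [].
have -> : Fps (fun n => (z ^+ n)%:A : A) = Fps (fun n => z%:A ^+ n).
  by apply: fpsP => n /=; rewrite !algE rmorphXn.
rewrite fps_mul_geometric.
  by rewrite !algE !rmorphB rmorphXn rmorph1.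
by rewrite algE -!rmorphXn z3 !rmorphD rmorph1.
Qed.

Lemma mul_lincomb_alg (K : comNzRingType) (A : algType K) (i j k : A)
    (u x y t : K) :
  (1 + x *: i + y *: j + t *: k) * u%:A
  = u%:A + (u * x) *: i + (u * y) *: j + (u * t) *: k.
Proof. by rewrite -scalerAr mulr1 !scalerDr !scalerA. Qed.

Lemma sum3_lincomb4 (K : nzRingType) (V : lmodType K) (i j k l : V)
    (x1 x2 x3 y1 y2 y3 z1 z2 z3 t1 t2 t3 : K) :
  (x1 + x2 + x3) *: l + (y1 + y2 + y3) *: i + (z1 + z2 + z3) *: j
    + (t1 + t2 + t3) *: k
  = (x1 *: l + y1 *: i + z1 *: j + t1 *: k)
    + (x2 *: l + y2 *: i + z2 *: j + t2 *: k)
    + (x3 *: l + y3 *: i + z3 *: j + t3 *: k).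
Proof.
rewrite !scalerDl.
rewrite (addrACA _ (t1 *: k)) (addrACA _ (z1 *: j)) (addrACA _ (y1 *: i)).
rewrite (addrACA _ (t1 *: k + _)) (addrACA _ (z1 *: j + _)).
by rewrite (addrACA _ (y1 *: i + _)).
Qed.

(** Splitting [z ^ (n + a)] into [z ^ n * z ^ a] makes the series a constant quaternion times the
    geometric series; since [a] may be negative, this uses [z != 0]. *)
Lemma fps_quat_geometric (K : fieldType) (a b c : int) (z z' : K) :
  z != 0 -> z ^+ 3 = z ^+ 2 + z + 2 -> z ^+ 2 - z - 1 = z' ->
  Fps (fun n : nat => (z ^ n)%:A + z ^ (n%:Z + a) *: quat_i
      + z ^ (n%:Z + b) *: quat_j + z ^ (n%:Z + c) *: quat_k)
    * (1 - fpsX - fpsX ^+ 2 - 2 *: fpsX ^+ 3)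
  = (1 + z ^ a *: quat_i + z ^ b *: quat_j + z ^ c *: quat_k : quat K)
    *: (1 + (z - 1)%:A *: fpsX + z'%:A *: fpsX ^+ 2).
Proof.
move=> z0 z3 zz'; rewrite -(fps_mul_geometric_alg _ _ _ _ z3 zz') [RHS]scalerAl.
congr (_ * _); apply: fpsP => n.
by rewrite /= mul_lincomb_alg !expfzDr.
Qed.

Lemma fps_quat_generating_function (K : fieldType) (a b c : int)
    (z1 z2 z3 z1' z2' z3' : K)
    (Z := fun z d : K => z ^+ 3 = z ^+ 2 + z + 2 /\ z ^+ 2 - z - 1 = d)
    (u := fun m : int => z1 ^ m + z2 ^ m + z3 ^ m)
    (P := fun z : K =>
       1 + z ^ a *: quat_i + z ^ b *: quat_j + z ^ c *: quat_k : quat K)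
    (N := fun z z' : K =>
       1 + (z - 1)%:A *: fpsX + z'%:A *: fpsX ^+ 2 : fps (quat K)) :
  z1 != 0 -> z2 != 0 -> z3 != 0 -> Z z1 z1' -> Z z2 z2' -> Z z3 z3' ->
  Fps (fun n : nat => (u n)%:A + u (n%:Z + a) *: quat_i
      + u (n%:Z + b) *: quat_j + u (n%:Z + c) *: quat_k)
  = (P z1 *: N z1 z1' + P z2 *: N z2 z2' + P z3 *: N z3 z3')
    / (1 - fpsX - fpsX ^+ 2 - 2 *: fpsX ^+ 3).
Proof.
move=> z1_neq0 z2_neq0 z3_neq0 [c1 d1] [c2 d2] [c3 d3].
rewrite /P /N -!fps_quat_geometric // -!mulrDl mulrK.
  by apply: fpsP => n; exact: sum3_lincomb4.
(* Cancelling the denominator requires it to be a unit: its constant coefficient is 1. *)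
set D := (X in X \is a _); have D0 : fps_coef D 0 = 1.
  rewrite /D scaler_nat !exprS expr0 mulr1 mulr2n /= !big_ord1 /=.
  by rewrite !mul0r !addr0 !subr0.
by change (fps_coef D 0 \is a GRing.unit); rewrite D0 unitr1.
Qed.

Lemma omega1_sq (R : realType) : omega1 ^+ 2 = - 1 - omega1 :> R[i].
Proof.
have sq3 : (Num.sqrt 3)%:C%C ^+ 2 = 3 :> R[i].
  by rewrite -rmorphXn /= sqr_sqrtr ?ler0n // rmorph_nat.
have i2 := @sqr_i R.
have two0 : 2 != 0 :> R[i] by rewrite pnatr_eq0.
by rewrite /omega1; field: sq3 i2.
Qed.

Lemma omega2E (R : realType) : omega2 = - 1 - omega1 :> R[i].
Proof.
have two0 : 2 != 0 :> R[i] by rewrite pnatr_eq0.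
by rewrite /omega1 /omega2; field.
Qed.

Lemma omega1_neq0 (R : realType) : omega1 != 0 :> R[i].
Proof.
apply/eqP => w0; have := omega1_sq R.
by rewrite w0 expr0n subr0 => /eqP; rewrite eq_sym oppr_eq0 oner_eq0.
Qed.

(** The second root is the square of the first. *)
Lemma omega2_neq0 (R : realType) : omega2 != 0 :> R[i].
Proof. by rewrite omega2E -omega1_sq expf_neq0 ?omega1_neq0. Qed.

Theorem theorem2p7 (R : realType) (a b c : int) :
  let w1 : R[i] := omega1 in
  let w2 : R[i] := omega2 in
  let Theta : quat R[i] :=
    1 + 2 ^ a *: quat_i + 2 ^ b *: quat_j + 2 ^ c *: quat_k in
  let Phi1 : quat R[i] :=
    1 + w1 ^ a *: quat_i + w1 ^ b *: quat_j + w1 ^ c *: quat_k in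
  let Phi2 : quat R[i] :=
    1 + w2 ^ a *: quat_i + w2 ^ b *: quat_j + w2 ^ c *: quat_k in
  Fps (fun j : nat => jacQK R a b c j%:Z) =
    (Theta *: (1 + fpsX + fpsX ^+ 2)
     + Phi1 *: (1 + (w1 - 1)%:A *: fpsX + (2 * w2)%:A *: fpsX ^+ 2)
     + Phi2 *: (1 + (w2 - 1)%:A *: fpsX + (2 * w1)%:A *: fpsX ^+ 2))
    / (1 - fpsX - fpsX ^+ 2 - 2 *: fpsX ^+ 3).
Proof.
move=> w1 w2 Theta Phi1 Phi2.
have w1sq : w1 ^+ 2 = - 1 - w1 := omega1_sq R.
have w2E : w2 = - 1 - w1 := omega2E R.
have two0 : 2 != 0 :> R[i] by rewrite pnatr_eq0.
(* The values of [z ^+ 2 - z - 1] are 1 at 2, and [- 2 - 2 * w1 = 2 * w2] at [w1]; symmetrically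
   [2 * w1] at [w2]. *)
have gf := @fps_quat_generating_function R[i] a b c 2 w1 w2 1 (2 * w2) (2 * w1)
  two0 (omega1_neq0 R) (omega2_neq0 R).
(* At the root 2 both nontrivial numerator coefficients are 1, which leaves
   [1 + fpsX + fpsX ^+ 2]. *)
have e1 : 2 - 1 = 1 :> R[i] by ring.
move: gf; rewrite e1 !scale1r => gf; apply: gf; split.
(* For each root, the cubic relation and the quadratic value remain; eliminating [w2] and reducing
   squares of [w1] settles them. *)
all: ring: w1sq w2E.
Qed.
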